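(* Let $\mathcal U$ be a universal Martin-Löf test. There is a $\Sigma^0_2$ set $\mathcal A\subseteq 2^\omega$ such that $\chi_{\mathcal A}\restriction\mathrm{MLR}\not\le_{\mathrm W}\mathsf{LAY}_{\mathcal U}$.
   Context: Cantor space $2^\omega$, Lebesgue measure $\lambda$. A Martin-Löf (ML) test is a sequence $(\mathcal V_i)_{i\in\omega}$ of open subsets of $2^\omega$ such that $\{\langle i,\sigma\rangle:[\sigma]\subseteq\mathcal V_i\}$ is c.e. and $\lambda(\mathcal V_i)\le 2^{-i}$; it is universal if $\bigcap_i\mathcal V'_i\subseteq\bigcap_i\mathcal V_i$ for every ML-test $\mathcal V'$. $\mathrm{MLR}$ is the set of Martin-Löf random sequences. A set $\mathcal A\subseteq 2^\omega$ is $\Sigma^0_2$ if it is definable in the form $\{X:\exists s_0\,\forall s>s_0\,R(X,s)\}$ for a computable (oracle) predicate $R$, equivalently $\mathcal A=\bigcup_i[T_i]$ for a uniformly computable sequence of trees $T_i\subseteq 2^{<\omega}$. $\chi_{\mathcal A}$ is the characteristic function of $\mathcal A$, with values in $\{0,1\}\subseteq\omega$. A representation of a set $X$ is a surjective partial map $\delta_X:\subseteq\omega^\omega\to X$. A realizer of a multi-valued partial function $f:\subseteq X\rightrightarrows Y$ is a partial $\Gamma:\subseteq\omega^\omega\to\omega^\omega$ with $\delta_Y(\Gamma(p))\in f(\delta_X(p))$ for all $p\in\mathrm{dom}(f\circ\delta_X)$. $f\le_{\mathrm W} g$ if there are Turing functionals $\Phi,\Psi$ such that $p\mapsto\Psi(\langle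 p,\Gamma(\Phi(p))\rangle)$ realizes $f$ for every realizer $\Gamma$ of $g$. $\mathrm{MLR}$ is represented by the identity on $\mathrm{MLR}\subseteq\omega^\omega$, $\omega$ by $\chi_{\{n\}}\mapsto n$. $\mathsf{LAY}_{\mathcal U}\colon\mathrm{MLR}\rightrightarrows\omega$, $\mathsf{LAY}_{\mathcal U}(X)=\{i:X\notin\mathcal U_i\}$. *)

(* Defs.v *)
From Stdlib Require Import Arith List Reals.
Import ListNotations.

Definition pair (a b : nat) : nat := (a + b) * (a + b + 1) / 2 + b.

Inductive prf : Type :=
| PZero : prf
| PSucc : prf
| PId   : prf
| PFst  : prf
| PSnd  : prf
| POrc  : prf
| PComp : prf -> prf -> prf
| PPair : prf -> prf -> prf
| PRec  : prf -> prf -> prf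
| PMu   : prf -> prf.

Inductive eval (X : nat -> nat) : prf -> nat -> nat -> Prop :=
| ev_zero x : eval X PZero x 0
| ev_succ x : eval X PSucc x (S x)
| ev_id x : eval X PId x x
| ev_fst a b : eval X PFst (pair a b) a
| ev_snd a b : eval X PSnd (pair a b) b
| ev_orc x : eval X POrc x (X x)
| ev_comp f g x y z : eval X g x y -> eval X f y z -> eval X (PComp f g) x z
| ev_pair f g x y z : eval X f x y -> eval X g x z -> eval X (PPair f g) x (pair y z)
| ev_rec0 f g a y : eval X f a y -> eval X (PRec f g) (pair a 0) y
| ev_recS f g a n y z :
    eval X (PRec f g) (pair a n) y ->
    eval X g (pair a (pair n y)) z ->
    eval X (PRec f g) (pair a (S n)) z
| ev_mu f x n :
    eval X f (pair x n) 0 ->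
    (forall m, m < n -> exists k, k <> 0 /\ eval X f (pair x m) k) ->
    eval X (PMu f) x n.

Definition baire := nat -> nat.
Definition cantor := nat -> bool.
Definition b2n (b : bool) : nat := if b then 1 else 0.
Definition to_baire (X : cantor) : baire := fun n => b2n (X n).
Definition is_cantor (p : baire) : Prop := forall n, p n = 0 \/ p n = 1.
Definition to_cantor (p : baire) : cantor := fun n => Nat.eqb (p n) 1.

Definition tf (e : prf) (p q : baire) : Prop := forall n, eval p e n (q n).

Definition join (p q : baire) : baire :=
  fun n => if Nat.even n then p (Nat.div2 n) else q (Nat.div2 n).

Definition ce (W : nat -> Prop) : Prop :=
  exists e : prf, forall x, W x <-> exists y, eval (fun _ => 0) e x y.

Fixpoint code (s : list bool) : nat :=
  match s with [] => 0 | b :: s' => S (pair (b2n b) (code s')) end.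
Definition cyl (s : list bool) (X : cantor) : Prop :=
  forall k, k < length s -> X k = nth k s false.
Definition prefix (s t : list bool) : Prop := exists u, t = s ++ u.
Definition incomparable (s t : list bool) : Prop := ~ prefix s t /\ ~ prefix t s.

(** Lebesgue measure of an open set V is the supremum of the measures of
    finite disjoint unions of cylinders contained in V; hence
    lambda(V) <= r  iff every finite antichain of strings whose cylinders lie
    in V has total measure sum 2^{-|s|} <= r. *)
Definition measure_open_le (V : cantor -> Prop) (r : R) : Prop :=
  forall L : list (list bool),
    NoDup L ->
    (forall s t, In s L -> In t L -> s <> t -> incomparable s t) ->
    (forall s, In s L -> forall X, cyl s X -> V X) ->
    (fold_right (fun s acc => (/2) ^ length s + acc) 0 L <= r)%R.

Definition is_open (V : cantor -> Prop) : Prop :=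
  forall X, V X -> exists s, cyl s X /\ forall Y, cyl s Y -> V Y.

Definition ML_test (V : nat -> cantor -> Prop) : Prop :=
  (forall i, is_open (V i)) /\
  ce (fun n => exists i s, n = pair i (code s) /\ forall X, cyl s X -> V i X) /\
  (forall i, measure_open_le (V i) ((/2) ^ i)%R).

Definition universal_ML_test (U : nat -> cantor -> Prop) : Prop :=
  ML_test U /\
  forall V, ML_test V -> forall X, (forall i, V i X) -> (forall i, U i X).

Definition MLR (X : cantor) : Prop :=
  forall V, ML_test V -> ~ (forall i, V i X).

Definition Sigma02 (A : cantor -> Prop) : Prop :=
  exists e : prf,
    (forall (X : cantor) s, exists y, eval (to_baire X) e s y) /\
    (forall X : cantor,
        A X <-> exists s0, forall s, s > s0 -> eval (to_baire X) e s 0).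

Definition nat_name (n : nat) : baire := fun k => if Nat.eqb k n then 1 else 0.

Definition chi (A : cantor -> Prop) (X : cantor) (n : nat) : Prop :=
  (A X /\ n = 1) \/ (~ A X /\ n = 0).

Definition MLR_name (p : baire) : Prop := is_cantor p /\ MLR (to_cantor p).

(* Gamma (a partial map, given as its graph, functional) realizes
   LAY_U : MLR =>> omega,  LAY_U(X) = {i : X notin U_i}. *)
Definition partial_fun (G : baire -> baire -> Prop) : Prop :=
  forall p q q', G p q -> G p q' -> forall n, q n = q' n.

Definition realizes_LAY (U : nat -> cantor -> Prop) (G : baire -> baire -> Prop) : Prop :=
  partial_fun G /\
  forall p, MLR_name p ->
    exists q, G p q /\
    forall q, G p q -> exists i, (forall k, q k = nat_name i k) /\ ~ U i (to_cantor p).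

Definition chiMLR_leW_LAY (A : cantor -> Prop) (U : nat -> cantor -> Prop) : Prop :=
  exists Phi Psi : prf,
    forall G, realizes_LAY U G ->
      forall p, MLR_name p ->
        exists r q n,
          tf Phi p r /\ G r q /\ tf Psi (join p q) (nat_name n) /\
          chi A (to_cantor p) n.

(* Main.v *)
(** Assign to each pair [e] of programs [(Phi, Psi)] the sequences [X] extending
    [0^e 1].  For such an [X], let [i_s] be the least [i] for which [Phi^X] has not
    been seen to enter [U_i] by stage [s]; if [Phi^X] is random then [i_s] converges
    to the least [i] with [Phi^X] outside [U_i].  Let [X] be in [A] iff for almost
    all [s] the computation of [Psi] from [X] and [i_s] is seen at stage [s] to
    answer "no".  A realizer of [LAY_U] that returns least layers then refutes
    [(Phi, Psi)] at every random [X] extending [0^e 1]; such an [X] exists because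
    that cylinder has measure larger than [U_(e+2)], and any sequence outside some
    component of the universal test is random. *)

From Stdlib Require Import Arith Lia List Reals Lra Classical FunctionalExtensionality.
From Stdlib Require Cantor.
Import ListNotations.
Require Import Defs.

(** * Projections of the pairing function *)

Definition pi1 (n : nat) : nat := fst (Cantor.of_nat n).
Definition pi2 (n : nat) : nat := snd (Cantor.of_nat n).

(** The library formula is stated after doubling, which makes the division by [2] exact. *)
Lemma pair_cantor a b : pair a b = Cantor.to_nat (a, b).
Proof.
  pose proof (Cantor.to_nat_spec a b) as H. unfold pair.
  assert (E : (a + b) * (a + b + 1) = (Cantor.to_nat (a, b) - b) * 2) by nia.
  rewrite E, Nat.div_mul by lia. nia.
Qed.

Lemma pi1_pair a b : pi1 (pair a b) = a.
Proof. unfold pi1. now rewrite pair_cantor, Cantor.cancel_of_to. Qed.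

Lemma pi2_pair a b : pi2 (pair a b) = b.
Proof. unfold pi2. now rewrite pair_cantor, Cantor.cancel_of_to. Qed.

Lemma pair_pi n : pair (pi1 n) (pi2 n) = n.
Proof.
  unfold pi1, pi2. rewrite pair_cantor, <- surjective_pairing.
  apply Cantor.cancel_to_of.
Qed.

Lemma pair_inj a b a' b' : pair a b = pair a' b' -> a = a' /\ b = b'.
Proof.
  intros H. split.
  - now rewrite <- (pi1_pair a b), H, pi1_pair.
  - now rewrite <- (pi2_pair a b), H, pi2_pair.
Qed.

Lemma pair_ge_r a b : b <= pair a b.
Proof. apply Nat.le_add_l. Qed.

Global Opaque pair pi1 pi2.

(** * Functions computable uniformly in the oracle *)

(** One program serves all oracles, and only total functionals qualify; partial computations enter
    later through the step-bounded [run]. *)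
Definition computable (F : baire -> nat -> nat) : Prop :=
  exists e, forall X n, eval X e n (F X n).

Lemma computable_ext (F G : baire -> nat -> nat) :
  (forall X n, F X n = G X n) -> computable F -> computable G.
Proof. intros E [e H]. exists e. intros X n. rewrite <- E. apply H. Qed.

Lemma computable_comp F G :
  computable F -> computable G -> computable (fun X n => F X (G X n)).
Proof. intros [f Hf] [g Hg]. exists (PComp f g). intros. econstructor; eauto. Qed.

Lemma computable_id : computable (fun X n => n).
Proof. exists PId. constructor. Qed.

Lemma computable_succ F : computable F -> computable (fun X n => S (F X n)).
Proof. apply (computable_comp (fun _ => S)). exists PSucc. constructor. Qed.

Lemma computable_const k : computable (fun _ _ => k).
Proof. induction k; [exists PZero; constructor | now apply computable_succ]. Qed.

Lemma computable_pi1 F : computable F -> computable (fun X n => pi1 (F X n)).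
Proof.
  apply (computable_comp (fun _ => pi1)). exists PFst. intros X n.
  rewrite <- (pair_pi n) at 1. constructor.
Qed.

Lemma computable_pi2 F : computable F -> computable (fun X n => pi2 (F X n)).
Proof.
  apply (computable_comp (fun _ => pi2)). exists PSnd. intros X n.
  rewrite <- (pair_pi n) at 1. constructor.
Qed.

Lemma computable_oracle F : computable F -> computable (fun X n => X (F X n)).
Proof. apply (computable_comp (fun X => X)). exists POrc. constructor. Qed.

Lemma computable_pair F G :
  computable F -> computable G -> computable (fun X n => pair (F X n) (G X n)).
Proof. intros [f Hf] [g Hg]. exists (PPair f g). intros. constructor; auto. Qed.

(** Programs are unary, so a body with one more bound variable is stated on a packed argument [z];
    the closure lemmas below use the same convention. *)
Lemma computable_app2 H F G :
  computable (fun X z => H X (pi1 z) (pi2 z)) -> computable F -> computable G ->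
  computable (fun X n => H X (F X n) (G X n)).
Proof.
  intros HH HF HG.
  apply computable_ext with
    (2 := computable_comp _ _ HH (computable_pair _ _ HF HG)).
  intros. cbn beta. now rewrite pi1_pair, pi2_pair.
Qed.

Lemma computable_rec F G N :
  computable F -> computable (fun X z => G X (pi1 z) (pi1 (pi2 z)) (pi2 (pi2 z))) ->
  computable N ->
  computable (fun X n =>
    nat_rec (fun _ => nat) (F X n) (fun k y => G X n k y) (N X n)).
Proof.
  intros [f Hf] [g Hg] HN.
  apply (computable_app2 (fun X n m => nat_rec (fun _ => nat) (F X n) (fun k y => G X n k y) m));
    [|apply computable_id|exact HN].
  exists (PRec f g). intros X z. rewrite <- (pair_pi z) at 1.
  generalize (pi1 z) (pi2 z). intros a n. induction n as [|n IH]; cbn.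
  - constructor. apply Hf.
  - econstructor; [exact IH|].
    specialize (Hg X (pair a (pair n (nat_rec (fun _ => nat) (F X a) (fun k y => G X a k y) n)))).
    cbn beta in Hg. now rewrite !pi2_pair, !pi1_pair in Hg.
Qed.

(** A case distinction is a primitive recursion that ignores its recursive value. *)
Lemma computable_case F G N :
  computable N -> computable F -> computable (fun X z => G X (pi1 z) (pi2 z)) ->
  computable (fun X n => match N X n with 0 => F X n | S u => G X n u end).
Proof.
  intros HN HF HG.
  eapply computable_ext; [|apply (computable_rec F (fun X n k _ => G X n k) N HF);
    [|exact HN]].
  - intros X n. cbn beta. now destruct (N X n).
  - apply (computable_app2 G); [exact HG|apply computable_pi1, computable_id|].
    apply computable_pi1, computable_pi2, computable_id.
Qed.

Lemma computable_iter F G N :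
  computable F -> computable (fun X z => G X (pi1 z) (pi2 z)) -> computable N ->
  computable (fun X n => Nat.iter (N X n) (G X n) (F X n)).
Proof.
  intros HF HG HN.
  eapply computable_ext; [|apply (computable_rec F (fun X n _ y => G X n y) N HF);
    [|exact HN]].
  - intros X n. cbn beta. induction (N X n) as [|m IH]; cbn; [easy|now f_equal].
  - apply (computable_app2 G); [exact HG|apply computable_pi1, computable_id|].
    apply computable_pi2, computable_pi2, computable_id.
Qed.

(** The least [k < n] with [f k <> 0], and [n] if there is none. *)
Definition search (f : nat -> nat) (n : nat) : nat :=
  Nat.iter n (fun y => match f y with 0 => S y | S _ => y end) 0.

Lemma search_spec f n :
  search f n <= n /\ (forall j, j < search f n -> f j = 0) /\
  (search f n < n -> f (search f n) <> 0).
Proof.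
  unfold search. induction n as [|n (H1 & H2 & H3)]; [cbn; repeat split; lia|].
  rewrite Nat.iter_succ.
  set (y := Nat.iter n _ 0) in *.
  destruct (f y) eqn:E.
  - repeat split; [lia| |].
    + intros j Hj. destruct (Nat.eq_dec j y); [now subst|apply H2; lia].
    + intros Hlt. exfalso. apply H3; [lia|reflexivity].
  - repeat split; [lia|exact H2|now rewrite E].
Qed.

Lemma search_eq f n k :
  k < n -> (forall j, j < k -> f j = 0) -> f k <> 0 -> search f n = k.
Proof.
  intros Hk Hj Hf. destruct (search_spec f n) as (H1 & H2 & H3).
  destruct (Nat.lt_trichotomy (search f n) k) as [H|[H|H]]; [|exact H|].
  - exfalso. apply H3; [lia|]. now apply Hj.
  - exfalso. apply Hf. now apply H2.
Qed.

Lemma search_lt f n : search f n < n <-> exists k, k < n /\ f k <> 0.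
Proof.
  destruct (search_spec f n) as (H1 & H2 & H3). split.
  - intros H. exists (search f n). auto.
  - intros (k & Hk & Hf). destruct (Nat.le_gt_cases (search f n) k); [lia|].
    exfalso. apply Hf. now apply H2.
Qed.

Lemma computable_search G N :
  computable (fun X z => G X (pi1 z) (pi2 z)) -> computable N ->
  computable (fun X n => search (G X n) (N X n)).
Proof.
  intros HG HN. unfold search.
  apply (computable_iter _ (fun X n y => match G X n y with 0 => S y | S _ => y end));
    [apply computable_const| |exact HN].
  apply computable_case; [exact HG| |].
  - apply computable_succ, computable_pi2, computable_id.
  - apply computable_pi2, computable_pi1, computable_id.
Qed.

Lemma computable_add F G :
  computable F -> computable G -> computable (fun X n => F X n + G X n).
Proof.
  intros HF HG.
  eapply computable_ext; [|apply (computable_iter G (fun _ _ y => S y) F HG);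
    [apply computable_succ, computable_pi2, computable_id|exact HF]].
  intros X n. cbn beta. induction (F X n) as [|m IH]; cbn; [easy|now f_equal].
Qed.

Lemma computable_sub F G :
  computable F -> computable G -> computable (fun X n => F X n - G X n).
Proof.
  intros HF HG.
  eapply computable_ext; [|apply (computable_iter F
     (fun _ _ y => match y with 0 => 0 | S u => u end) G HF); [|exact HG]].
  - intros X n. cbn beta. induction (G X n) as [|m IH]; [cbn; lia|].
    rewrite Nat.iter_succ, IH. destruct (F X n - m) eqn:E; lia.
  - apply (computable_case (fun _ _ => 0) (fun _ _ u => u) (fun X z => pi2 z)).
    + apply computable_pi2, computable_id.
    + apply computable_const.
    + apply computable_pi2, computable_id.
Qed.

(** Half of [m], rounded down, is the least [k] with [2k + 2 > m], so a search below [S m] finds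
    it. *)
Lemma computable_div2 F : computable F -> computable (fun X n => Nat.div2 (F X n)).
Proof.
  intros HF.
  eapply computable_ext; [|apply (computable_search
     (fun X n k => S (S (k + k)) - F X n) (fun X n => S (F X n)))].
  - intros X n. cbn beta. generalize (F X n). clear. intros m.
    pose proof (Nat.div2_odd m) as H.
    assert (Nat.b2n (Nat.odd m) <= 1) by (destruct (Nat.odd m); cbn; lia).
    apply search_eq; intros; lia.
  - apply computable_sub.
    + apply computable_succ, computable_succ, computable_add;
        apply computable_pi2, computable_id.
    + apply (computable_comp F); [exact HF|apply computable_pi1, computable_id].
  - now apply computable_succ.
Qed.

(** The case distinction is on the parity bit [N - 2 * div2 N]. *)
Lemma computable_if_even F G N :
  computable N -> computable F -> computable G ->
  computable (fun X n => if Nat.even (N X n) then F X n else G X n).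
Proof.
  intros HN HF HG.
  eapply computable_ext;
    [|apply (computable_case F (fun X n _ => G X n)
        (fun X n => N X n - (Nat.div2 (N X n) + Nat.div2 (N X n)))); [|exact HF|]].
  - intros X n. cbn beta. pose proof (Nat.div2_odd (N X n)) as H.
    rewrite <- Nat.negb_odd. destruct (Nat.odd (N X n)); cbn in *.
    + replace (N X n - _) with 1 by lia. easy.
    + replace (N X n - _) with 0 by lia. easy.
  - apply computable_sub; [exact HN|].
    apply computable_add; now apply computable_div2.
  - apply (computable_comp G); [exact HG|apply computable_pi1, computable_id].
Qed.

(** The two truncated differences sum to the distance, which is zero exactly at equality. *)
Lemma computable_eqb F G :
  computable F -> computable G ->
  computable (fun X n => if Nat.eqb (F X n) (G X n) then 1 else 0).
Proof.
  intros HF HG.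
  eapply computable_ext;
    [|apply (computable_case (fun _ _ => 1) (fun _ _ _ => 0)
        (fun X n => (F X n - G X n) + (G X n - F X n)));
      [|apply computable_const|apply computable_const]].
  - intros X n. cbn beta. destruct (Nat.eqb_spec (F X n) (G X n)).
    + now replace (F X n - G X n + _) with 0 by lia.
    + now destruct (F X n - G X n + (G X n - F X n)) eqn:?; [lia|].
  - apply computable_add; now apply computable_sub.
Qed.

(** * A universal machine *)

(** The successor keeps nonempty stacks apart from the empty stack [0]. *)
Definition push (f K : nat) : nat := S (pair f K).

Fixpoint cd (e : prf) : nat :=
  match e with
  | PZero => pair 0 0
  | PSucc => pair 1 0
  | PId => pair 2 0
  | PFst => pair 3 0
  | PSnd => pair 4 0
  | POrc => pair 5 0
  | PComp f g => pair 6 (pair (cd f) (cd g))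
  | PPair f g => pair 7 (pair (cd f) (cd g))
  | PRec f g => pair 8 (pair (cd f) (cd g))
  | PMu f => pair 9 (cd f)
  end.

(** The frames are continuations: [frame_mk] holds a first component awaiting the second,
    [frame_snd] the program and input for a second component, [frame_test] the candidate [m] of an
    unbounded search. Their tags follow those of [cd]. *)
Definition frame_mk (y : nat) : nat := pair 10 y.
Definition frame_snd (g x : nat) : nat := pair 11 (pair g x).
Definition frame_test (f x m : nat) : nat := pair 12 (pair f (pair x m)).

(** A state [pair v K] is a current value [v] and a stack [K] of instructions
    still to be applied to it; an instruction is a program code or one of the
    three auxiliary frames. *)
Definition step (O : nat -> nat) (st : nat) : nat :=
  match pi2 st with
  | 0 => st
  | S k =>
    match pi1 (pi1 k) with
    | 0 => pair 0 (pi2 k)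
    | 1 => pair (S (pi1 st)) (pi2 k)
    | 2 => pair (pi1 st) (pi2 k)
    | 3 => pair (pi1 (pi1 st)) (pi2 k)
    | 4 => pair (pi2 (pi1 st)) (pi2 k)
    | 5 => pair (O (pi1 st)) (pi2 k)
    | 6 => pair (pi1 st) (push (pi2 (pi2 (pi1 k))) (push (pi1 (pi2 (pi1 k))) (pi2 k)))
    | 7 => pair (pi1 st) (push (pi1 (pi2 (pi1 k)))
                           (push (frame_snd (pi2 (pi2 (pi1 k))) (pi1 st)) (pi2 k)))
    | 8 => match pi2 (pi1 st) with
           | 0 => pair (pi1 (pi1 st)) (push (pi1 (pi2 (pi1 k))) (pi2 k))
           | S n => pair (pair (pi1 (pi1 st)) n)
                      (push (pi1 k) (push (frame_mk n) (push (frame_mk (pi1 (pi1 st)))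
                        (push (pi2 (pi2 (pi1 k))) (pi2 k)))))
           end
    | 9 => pair (pair (pi1 st) 0) (push (pi2 (pi1 k))
              (push (frame_test (pi2 (pi1 k)) (pi1 st) 0) (pi2 k)))
    | 10 => pair (pair (pi2 (pi1 k)) (pi1 st)) (pi2 k)
    | 11 => pair (pi2 (pi2 (pi1 k)))
              (push (pi1 (pi2 (pi1 k))) (push (frame_mk (pi1 st)) (pi2 k)))
    | _ => match pi1 st with
           | 0 => pair (pi2 (pi2 (pi2 (pi1 k)))) (pi2 k)
           | S _ =>
             pair (pair (pi1 (pi2 (pi2 (pi1 k)))) (S (pi2 (pi2 (pi2 (pi1 k))))))
               (push (pi1 (pi2 (pi1 k)))
                 (push (frame_test (pi1 (pi2 (pi1 k))) (pi1 (pi2 (pi2 (pi1 k))))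
                          (S (pi2 (pi2 (pi2 (pi1 k)))))) (pi2 k)))
           end
    end
  end.

Ltac simpl_step :=
  cbn [cd]; unfold step, push at 1;
  unfold frame_mk at 1, frame_snd at 1, frame_test at 1;
  repeat rewrite ?pi1_pair, ?pi2_pair; try reflexivity.

Section Steps.
Variables (O : nat -> nat) (x K : nat).
Lemma step_zero : step O (pair x (push (cd PZero) K)) = pair 0 K.
Proof. simpl_step. Qed.
Lemma step_succ : step O (pair x (push (cd PSucc) K)) = pair (S x) K.
Proof. simpl_step. Qed.
Lemma step_id : step O (pair x (push (cd PId) K)) = pair x K.
Proof. simpl_step. Qed.
Lemma step_fst : step O (pair x (push (cd PFst) K)) = pair (pi1 x) K.
Proof. simpl_step. Qed.
Lemma step_snd : step O (pair x (push (cd PSnd) K)) = pair (pi2 x) K.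
Proof. simpl_step. Qed.
Lemma step_orc : step O (pair x (push (cd POrc) K)) = pair (O x) K.
Proof. simpl_step. Qed.
Lemma step_comp f g :
  step O (pair x (push (cd (PComp f g)) K)) = pair x (push (cd g) (push (cd f) K)).
Proof. simpl_step. Qed.
Lemma step_pair f g :
  step O (pair x (push (cd (PPair f g)) K))
  = pair x (push (cd f) (push (frame_snd (cd g) x) K)).
Proof. simpl_step. Qed.
Lemma step_rec0 f g :
  step O (pair (pair x 0) (push (cd (PRec f g)) K)) = pair x (push (cd f) K).
Proof. simpl_step. Qed.
Lemma step_recS f g n :
  step O (pair (pair x (S n)) (push (cd (PRec f g)) K))
  = pair (pair x n) (push (cd (PRec f g))
      (push (frame_mk n) (push (frame_mk x) (push (cd g) K)))).
Proof. simpl_step. Qed.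
Lemma step_mu f :
  step O (pair x (push (cd (PMu f)) K))
  = pair (pair x 0) (push (cd f) (push (frame_test (cd f) x 0) K)).
Proof. simpl_step. Qed.
Lemma step_frame_mk y : step O (pair x (push (frame_mk y) K)) = pair (pair y x) K.
Proof. simpl_step. Qed.
Lemma step_frame_snd g y :
  step O (pair y (push (frame_snd g x) K)) = pair x (push g (push (frame_mk y) K)).
Proof. simpl_step. Qed.
Lemma step_frame_test0 f m :
  step O (pair 0 (push (frame_test f x m) K)) = pair m K.
Proof. simpl_step. Qed.
Lemma step_frame_testS f m k :
  step O (pair (S k) (push (frame_test f x m) K))
  = pair (pair x (S m)) (push f (push (frame_test f x (S m)) K)).
Proof. simpl_step. Qed.
End Steps.

(** * Correctness of the machine *)

Definition reaches (O : nat -> nat) (a b : nat) : Prop :=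
  exists n, Nat.iter n (step O) a = b.

Lemma reaches_trans O a b c : reaches O a b -> reaches O b c -> reaches O a c.
Proof.
  intros [n <-] [m <-]. exists (m + n). now rewrite Nat.iter_add.
Qed.

Lemma reaches_step O a b : reaches O (step O a) b -> reaches O a b.
Proof. intros [n H]. exists (S n). now rewrite Nat.iter_succ_r. Qed.

Lemma reaches_refl O a : reaches O a a.
Proof. now exists 0. Qed.

Lemma eval_rec_inv O f g z y : eval O (PRec f g) z y ->
  (exists a, z = pair a 0 /\ eval O f a y) \/
  (exists a n u, z = pair a (S n) /\ eval O (PRec f g) (pair a n) u /\
                 eval O g (pair a (pair n u)) y).
Proof. intros H. inversion H; subst; eauto 10. Qed.

(** Induction on the program, with inner inductions on the counter of [PRec] and on the candidates
    of [PMu]. The stack is arbitrary because subprograms run above pending instructions. *)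
Lemma machine_complete O e : forall x y K, eval O e x y ->
  reaches O (pair x (push (cd e) K)) (pair y K).
Proof.
  induction e as [| | | | | |f IHf g IHg|f IHf g IHg|f IHf g IHg|f IHf];
    intros x y K H.
  - inversion H; subst. apply reaches_step. rewrite step_zero. apply reaches_refl.
  - inversion H; subst. apply reaches_step. rewrite step_succ. apply reaches_refl.
  - inversion H; subst. apply reaches_step. rewrite step_id. apply reaches_refl.
  - inversion H; subst. apply reaches_step. rewrite step_fst, pi1_pair. apply reaches_refl.
  - inversion H; subst. apply reaches_step. rewrite step_snd, pi2_pair. apply reaches_refl.
  - inversion H; subst. apply reaches_step. rewrite step_orc. apply reaches_refl.
  - inversion H; subst. apply reaches_step. rewrite step_comp.
    eapply reaches_trans; [apply IHg; eassumption|]. now apply IHf.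
  - inversion H; subst. apply reaches_step. rewrite step_pair.
    eapply reaches_trans; [apply IHf; eassumption|].
    apply reaches_step. rewrite step_frame_snd.
    eapply reaches_trans; [apply IHg; eassumption|].
    apply reaches_step. rewrite step_frame_mk. apply reaches_refl.
  - rewrite <- (pair_pi x) in *. revert y K H.
    generalize (pi1 x) (pi2 x). intros a n.
    induction n as [|n IH]; intros y K H;
      apply eval_rec_inv in H as [(b & E & Hf)|(b & k & u & E & Hr & Hg)];
      apply pair_inj in E as [<- E]; try discriminate.
    + apply reaches_step. rewrite step_rec0. now apply IHf.
    + injection E as <-. apply reaches_step. rewrite step_recS.
      eapply reaches_trans; [apply IH; eassumption|].
      (* The two frames turn the recursive value [u] into [pair a (pair k u)], the argument of
         [g]. *)
      apply reaches_step. rewrite step_frame_mk.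
      apply reaches_step. rewrite step_frame_mk. now apply IHg.
  - inversion H as [| | | | | | | | | |? ? ? H0 Hlt]; subst.
    apply reaches_step. rewrite step_mu.
    (* Each candidate below [y] evaluates to a nonzero value, so its test frame passes to the next
       one. *)
    assert (Hm : forall m, m <= y ->
      reaches O (pair (pair x 0) (push (cd f) (push (frame_test (cd f) x 0) K)))
                (pair (pair x m) (push (cd f) (push (frame_test (cd f) x m) K)))).
    { induction m as [|m IH]; intros Hm; [apply reaches_refl|].
      eapply reaches_trans; [apply IH; lia|].
      destruct (Hlt m Hm) as ([|k] & Hk & He); [easy|].
      eapply reaches_trans; [apply IHf; eassumption|].
      apply reaches_step. rewrite step_frame_testS. apply reaches_refl. }
    eapply reaches_trans; [apply Hm, le_n|].
    eapply reaches_trans; [apply IHf; eassumption|].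
    apply reaches_step. rewrite step_frame_test0. apply reaches_refl.
Qed.

Lemma push_not_halted x f K v : pair x (push f K) <> pair v 0.
Proof. intros H. apply pair_inj in H as [_ H]. discriminate. Qed.

(** Induction on the number of steps, not on [e], since [PRec] pushes its own code again. The bound
    [m < n] lets the hypothesis be applied again to the remaining stack. *)
Lemma machine_sound O n : forall e x K v,
  Nat.iter n (step O) (pair x (push (cd e) K)) = pair v 0 ->
  exists y m, m < n /\ eval O e x y /\ Nat.iter m (step O) (pair y K) = pair v 0.
Proof.
  induction n as [n IH] using lt_wf_ind. intros e x K v H.
  destruct n as [|n]; [now apply push_not_halted in H|].
  rewrite Nat.iter_succ_r in H.
  destruct e as [| | | | | |f g|f g|f g|f].
  - rewrite step_zero in H. exists 0, n. repeat split; [lia|constructor|exact H].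
  - rewrite step_succ in H. exists (S x), n. repeat split; [lia|constructor|exact H].
  - rewrite step_id in H. exists x, n. repeat split; [lia|constructor|exact H].
  - rewrite step_fst in H. exists (pi1 x), n. repeat split; [lia| |exact H].
    rewrite <- (pair_pi x) at 1. constructor.
  - rewrite step_snd in H. exists (pi2 x), n. repeat split; [lia| |exact H].
    rewrite <- (pair_pi x) at 1. constructor.
  - rewrite step_orc in H. exists (O x), n. repeat split; [lia|constructor|exact H].
  - rewrite step_comp in H.
    apply IH in H as (y & m & Hm & Hg & H); [|lia].
    apply IH in H as (z & m' & Hm' & Hf & H); [|lia].
    exists z, m'. repeat split; [lia|econstructor; eassumption|exact H].
  - rewrite step_pair in H.
    apply IH in H as (y & m & Hm & Hf & H); [|lia].
    destruct m as [|m]; [now apply push_not_halted in H|].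
    rewrite Nat.iter_succ_r, step_frame_snd in H.
    apply IH in H as (z & m' & Hm' & Hg & H); [|lia].
    destruct m' as [|m']; [now apply push_not_halted in H|].
    rewrite Nat.iter_succ_r, step_frame_mk in H.
    exists (pair y z), m'. repeat split; [lia|constructor; assumption|exact H].
  - rewrite <- (pair_pi x) in *. revert H. generalize (pi1 x) (pi2 x).
    intros a [|k] H.
    + rewrite step_rec0 in H. apply IH in H as (y & m & Hm & Hf & H); [|lia].
      exists y, m. repeat split; [lia|constructor; assumption|exact H].
    + rewrite step_recS in H. apply IH in H as (y & m & Hm & Hr & H); [|lia].
      destruct m as [|m]; [now apply push_not_halted in H|].
      rewrite Nat.iter_succ_r, step_frame_mk in H.
      destruct m as [|m]; [now apply push_not_halted in H|].
      rewrite Nat.iter_succ_r, step_frame_mk in H.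
      apply IH in H as (z & m' & Hm' & Hg & H); [|lia].
      exists z, m'. repeat split; [lia|econstructor; eassumption|exact H].
  - rewrite step_mu in H.
    (* Invariant of the search: all candidates below [m] have failed. The bound [n1 <= n] keeps the
       outer induction hypothesis available. *)
    assert (Hmu : forall n1, n1 <= n -> forall m,
      (forall m', m' < m -> exists k, k <> 0 /\ eval O f (pair x m') k) ->
      Nat.iter n1 (step O)
        (pair (pair x m) (push (cd f) (push (frame_test (cd f) x m) K))) = pair v 0 ->
      exists y j, j < n1 /\ eval O (PMu f) x y /\
                  Nat.iter j (step O) (pair y K) = pair v 0).
    { induction n1 as [n1 IH1] using lt_wf_ind. intros Hn1 m Hlt H1.
      apply IH in H1 as (k & j & Hj & Hf & H1); [|lia].
      destruct j as [|j]; [now apply push_not_halted in H1|].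
      rewrite Nat.iter_succ_r in H1. destruct k as [|k].
      - rewrite step_frame_test0 in H1. exists m, j.
        repeat split; [lia|constructor; assumption|exact H1].
      - rewrite step_frame_testS in H1.
        apply IH1 in H1 as (y & j' & Hj' & He & H1); [|lia|lia|].
        + exists y, j'. repeat split; [lia|exact He|exact H1].
        + intros m' Hm'. destruct (Nat.eq_dec m' m) as [->|]; [|apply Hlt; lia].
          exists (S k). split; [lia|exact Hf]. }
    apply Hmu in H as (y & j & Hj & He & H); [|lia|lia].
    exists y, j. repeat split; [lia|exact He|exact H].
Qed.

(** [S y] if the program [c] halts on [x] within [s] steps with value [y], else [0]. *)
Definition run (O : nat -> nat) (c x s : nat) : nat :=
  match pi2 (Nat.iter s (step O) (pair x (push c 0))) with
  | 0 => S (pi1 (Nat.iter s (step O) (pair x (push c 0))))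
  | S _ => 0
  end.

(** A state with empty stack is a fixed point of [step]. *)
Lemma run_mono O c x s s' y : run O c x s = S y -> s <= s' -> run O c x s' = S y.
Proof.
  unfold run. intros H Hs. replace s' with ((s' - s) + s) by lia.
  rewrite Nat.iter_add. set (st := Nat.iter s _ _) in *.
  replace (Nat.iter (s' - s) (step O) st) with st; [exact H|].
  induction (s' - s) as [|d IH]; [reflexivity|].
  rewrite Nat.iter_succ, <- IH. unfold step.
  destruct (pi2 st); [reflexivity|discriminate].
Qed.

Lemma run_complete O e x y :
  eval O e x y -> exists s0, forall s, s > s0 -> run O (cd e) x s = S y.
Proof.
  intros H. destruct (machine_complete O e x y 0 H) as [s0 Hs0].
  exists s0. intros s Hs. apply run_mono with s0; [|lia].
  unfold run. now rewrite Hs0, pi2_pair, pi1_pair.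
Qed.

Lemma run_sound O e x s y : run O (cd e) x s = S y -> eval O e x y.
Proof.
  unfold run. intros H. set (st := Nat.iter s _ _) in *.
  destruct (pi2 st) eqn:E; [|discriminate]. injection H as <-.
  assert (Hst : st = pair (pi1 st) 0) by (rewrite <- E; symmetry; apply pair_pi).
  destruct (machine_sound O s e x 0 (pi1 st) Hst) as (y & m & _ & He & Hm).
  assert (Hy : pair y 0 = pair (pi1 st) 0).
  { rewrite <- Hm. clear. induction m as [|m IH]; [reflexivity|].
    rewrite Nat.iter_succ, <- IH. unfold step. now rewrite pi2_pair. }
  apply pair_inj in Hy as [-> _]. exact He.
Qed.

(** Determinism is inherited from the machine: both values are read off at one common late stage. *)
Lemma eval_det O e x y y' : eval O e x y -> eval O e x y' -> y = y'.
Proof.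
  intros H H'. apply run_complete in H as [s Hs]. apply run_complete in H' as [s' Hs'].
  specialize (Hs (S (s + s')) ltac:(lia)). specialize (Hs' (S (s + s')) ltac:(lia)).
  congruence.
Qed.

(** * The diagonal set *)

(** Oracle [0] is [X], oracle [1] is the zero function and oracle [i + 2] is
    [X] together with the name of [i]. *)
Definition orc (X : baire) (m : nat) : baire := fun k =>
  match m with
  | 0 => X k
  | S u => match u with
           | 0 => 0
           | S i => if Nat.even k then X (Nat.div2 k)
                    else if Nat.eqb (Nat.div2 k) i then 1 else 0
           end
  end.

Ltac prove_computable :=
  repeat (cbn beta;
  lazymatch goal with
  | H : computable ?F |- computable ?F => exact H
  | |- computable (fun X n => match @?N X n with 0 => @?F X n | S u => @?G X n u end) =>
      apply (computable_case F G N)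
  | |- computable (fun X n => if Nat.even (@?N X n) then @?F X n else @?G X n) =>
      apply (computable_if_even F G N)
  | |- computable (fun X n => if Nat.eqb (@?F X n) (@?G X n) then 1 else 0) =>
      apply (computable_eqb F G)
  | |- computable (fun X n => search (@?G X n) (@?N X n)) => apply (computable_search G N)
  | |- computable (fun X n => Nat.iter (@?N X n) (@?G X n) (@?F X n)) =>
      apply (computable_iter F G N)
  | |- computable (fun X n => S (@?F X n)) => apply (computable_succ F)
  | |- computable (fun X n => pi1 (@?F X n)) => apply (computable_pi1 F)
  | |- computable (fun X n => pi2 (@?F X n)) => apply (computable_pi2 F)
  | |- computable (fun X n => Nat.div2 (@?F X n)) => apply (computable_div2 F)
  | |- computable (fun X n => pair (@?F X n) (@?G X n)) => apply (computable_pair F G)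
  | |- computable (fun X n => @?F X n + @?G X n) => apply (computable_add F G)
  | |- computable (fun X n => @?F X n - @?G X n) => apply (computable_sub F G)
  | |- computable (fun X n => X (@?F X n)) => apply (computable_oracle F)
  | |- computable (fun X n => n) => apply computable_id
  | H : computable ?F |- computable (fun X n => ?F X n) => exact H
  | H : computable ?F |- computable (fun X n => ?F X (@?G X n)) =>
      apply (computable_comp F G H)
  | |- computable (fun X n => ?k) => apply (computable_const k)
  end).

(** The oracle index is data, so a computed layer can select the oracle of a simulated run. *)
Lemma computable_step M V :
  computable M -> computable V ->
  computable (fun X n => step (orc X (M X n)) (V X n)).
Proof.
  intros HM HV.
  apply (computable_app2 (fun X m v => step (orc X m) v)); [|exact HM|exact HV].
  unfold step, push, frame_mk, frame_snd, frame_test, orc.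
  prove_computable.
Qed.

Lemma computable_run M C V T :
  computable M -> computable C -> computable V -> computable T ->
  computable (fun X n => run (orc X (M X n)) (C X n) (V X n) (T X n)).
Proof.
  intros HM HC HV HT. unfold run, push.
  assert (H : computable (fun X n => Nat.iter (T X n) (step (orc X (M X n)))
                (pair (V X n) (S (pair (C X n) 0))))).
  { prove_computable. apply computable_step; prove_computable. }
  prove_computable.
Qed.

Definition tail (k t : nat) : nat :=
  Nat.iter k (fun t => match t with 0 => 0 | S u => pi2 u end) t.

(** Nonzero iff entry [k] of the string coded by [t] exists and differs from the
    value at [k] that the program [c] has computed from [X] by stage [s]. *)
Definition mismatch (X : baire) (c t s k : nat) : nat :=
  match tail k t with
  | 0 => 0
  | S u => (run (orc X 0) c k s - S (pi1 u)) + (S (pi1 u) - run (orc X 0) c k s)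
  end.

(** Nonzero iff by stage [s] the string coded by [t] is seen to be an initial
    segment of the output of [c], and [w] to enumerate its cylinder into the
    [i]-th component of the test; [S t] bounds the length of that string. *)
Definition covers (w : nat) (X : baire) (c i s t : nat) : nat :=
  match run (orc X 1) w (pair i t) s with
  | 0 => 0
  | S _ => match S t - search (mismatch X c t s) (S t) with 0 => 1 | S _ => 0 end
  end.

(** Equals [1] iff no code [t < s] shows by stage [s] that the output of [c] lies in the [i]-th
    component. *)
Definition uncovered (w : nat) (X : baire) (c s i : nat) : nat :=
  match s - search (covers w X c i s) s with 0 => 1 | S _ => 0 end.

(** The [e] with [X] extending [0^e 1], once [s > e]. *)
Definition index (X : baire) (s : nat) : nat := search X s.

(** The approximation [i_s], with default [s] when every [i < s] is covered. *)
Definition layer (w : nat) (X : baire) (s : nat) : nat :=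
  search (uncovered w X (pi1 (index X s)) s) s.

(** The output is queried at position [1], where the names of [0] and [1] take the values [0] and
    [1]. An unfinished run counts as [1], so [0] appears only once the answer no has been
    computed. *)
Definition diag (w : nat) (X : baire) (s : nat) : nat :=
  match run (orc X (S (S (layer w X s)))) (pi2 (index X s)) 1 s with
  | 0 => 1
  | S v => v
  end.

Lemma computable_diag w : computable (diag w).
Proof.
  assert (Hrun : forall m, computable (fun X z =>
    run (orc X m) (pi1 z) (pi1 (pi2 z)) (pi2 (pi2 z)))).
  { intros m. apply computable_run; prove_computable. }
  assert (Hidx : computable index).
  { unfold index. prove_computable. }
  assert (Hlayer : computable (layer w)).
  { unfold layer, uncovered, covers, mismatch, tail. prove_computable.
    all: apply computable_run; prove_computable. }
  unfold diag.
  assert (H : computable (fun X s =>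
    run (orc X (S (S (layer w X s)))) (pi2 (index X s)) 1 s)).
  { apply computable_run; prove_computable. }
  prove_computable.
Qed.

(** * Properties of almost all stages *)

Definition eventually (P : nat -> Prop) : Prop := exists s0, forall s, s > s0 -> P s.

Lemma eventually_impl (P Q : nat -> Prop) :
  (forall s, P s -> Q s) -> eventually P -> eventually Q.
Proof. intros H [s0 Hs]. exists s0. auto. Qed.

Lemma eventually_and (P Q : nat -> Prop) :
  eventually P -> eventually Q -> eventually (fun s => P s /\ Q s).
Proof.
  intros [s0 H] [s1 H']. exists (s0 + s1). intros s Hs.
  split; [apply H|apply H']; lia.
Qed.

Lemma eventually_gt k : eventually (fun s => k < s).
Proof. now exists k. Qed.

Lemma eventually_forall_lt (P : nat -> nat -> Prop) n :
  (forall k, k < n -> eventually (P k)) -> eventually (fun s => forall k, k < n -> P k s).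
Proof.
  induction n as [|n IH]; intros H; [exists 0; intros; lia|].
  apply eventually_impl with (fun s => (forall k, k < n -> P k s) /\ P n s).
  - intros s [H1 H2] k Hk. destruct (Nat.eq_dec k n) as [->|]; [exact H2|apply H1; lia].
  - apply eventually_and; [apply IH; intros; apply H; lia|apply H; lia].
Qed.

(** * Codes of strings and names of sequences *)

Lemma tail_code (l : list bool) k :
  tail k (code l) = code (skipn k l).
Proof.
  revert l. induction k as [|k IH]; intros l; [reflexivity|].
  unfold tail. rewrite Nat.iter_succ_r. destruct l as [|b l]; cbn [code skipn].
  - specialize (IH []). now rewrite skipn_nil in IH.
  - rewrite pi2_pair. apply IH.
Qed.

Lemma tail_code_lt (l : list bool) k :
  k < length l -> exists u, tail k (code l) = S u /\ pi1 u = b2n (nth k l false).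
Proof.
  rewrite tail_code. revert l.
  induction k as [|k IH]; intros [|b l] H; cbn in *; try lia.
  - eexists. split; [reflexivity|apply pi1_pair].
  - apply IH. lia.
Qed.

Lemma length_le_code (l : list bool) : length l <= code l.
Proof.
  induction l as [|b l IH]; cbn; [lia|].
  pose proof (pair_ge_r (b2n b) (code l)). lia.
Qed.

Lemma b2n_inj a b : b2n a = b2n b -> a = b.
Proof. destruct a, b; easy. Qed.

Lemma code_inj l l' : code l = code l' -> l = l'.
Proof.
  revert l'. induction l as [|b l IH]; intros [|b' l'] H; try easy.
  injection H as H. apply pair_inj in H as [Hb Hl].
  now rewrite (b2n_inj _ _ Hb), (IH _ Hl).
Qed.

Lemma to_cantor_to_baire X : to_cantor (to_baire X) = X.
Proof. apply functional_extensionality. intros n. unfold to_cantor, to_baire. now destruct (X n). Qed.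

Lemma is_cantor_b2n p n : is_cantor p -> p n = b2n (to_cantor p n).
Proof. intros H. unfold to_cantor. now destruct (H n) as [-> | ->]. Qed.

(** Shows that the truncated difference used in [covers] and [uncovered] decides a bounded universal
    quantifier. *)
Lemma search_full f n : n - search f n = 0 <-> forall k, k < n -> f k = 0.
Proof.
  split.
  - intros H k Hk. destruct (Nat.eq_dec (f k) 0) as [|Hf]; [assumption|].
    assert (search f n < n) by (apply search_lt; eauto). lia.
  - intros H. destruct (Nat.eq_dec (n - search f n) 0) as [|Hn]; [assumption|].
    assert (Hlt : search f n < n) by lia. apply search_lt in Hlt as (k & Hk & Hf).
    now apply H in Hk.
Qed.

(** * Convergence of the layer approximation *)

Section Layer.
Variables (U : nat -> cantor -> Prop) (ew Phi : prf) (X r : baire).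
Hypothesis U_open : forall i, is_open (U i).
Hypothesis U_enum : forall x,
  (exists i s, x = pair i (code s) /\ forall Y, cyl s Y -> U i Y) <->
  exists y, eval (fun _ => 0) ew x y.
Hypothesis Phi_r : tf Phi X r.
Hypothesis r_cantor : is_cantor r.

(** This holds at every stage: halted runs are sound, so a covering would give a true cylinder
    inside [U i] containing [r]. *)
Lemma uncovered_outside i s :
  ~ U i (to_cantor r) -> uncovered (cd ew) X (cd Phi) s i = 1.
Proof.
  intros Hi. unfold uncovered.
  replace (s - _) with 0; [reflexivity|]. symmetry. apply search_full.
  intros t Ht. unfold covers.
  destruct (run (orc X 1) (cd ew) (pair i t) s) as [|y] eqn:Hw; [reflexivity|].
  destruct (S t - search _ _) eqn:Hm; [|reflexivity].
  exfalso. apply run_sound in Hw.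
  destruct (proj2 (U_enum (pair i t)) (ex_intro _ y Hw)) as (j & l & E & Hl).
  apply pair_inj in E as [<- ->]. apply Hi, Hl. intros k Hk.
  apply search_full with (k := k) in Hm; [|pose proof (length_le_code l); lia].
  unfold mismatch in Hm. destruct (tail_code_lt l k Hk) as (u & Hu & Hb).
  rewrite Hu, Hb in Hm.
  (* Both truncated differences vanish, which forces equality. *)
  assert (E : run (orc X 0) (cd Phi) k s = S (b2n (nth k l false))) by lia.
  apply run_sound in E. apply b2n_inj. rewrite <- is_cantor_b2n by assumption.
  exact (eval_det _ _ _ _ _ (Phi_r k) E).
Qed.

(** By openness one cylinder around [r] suffices; its finitely many output bits and its enumeration
    are seen by some stage, and later stages also exceed its code. *)
Lemma uncovered_inside i :
  U i (to_cantor r) -> eventually (fun s => uncovered (cd ew) X (cd Phi) s i = 0).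
Proof.
  intros Hi. destruct (U_open i _ Hi) as (l & Hl & HU).
  destruct (proj1 (U_enum (pair i (code l)))) as [y Hy]; [eauto|].
  assert (HPhi : eventually (fun s => forall k, k < length l ->
            run (orc X 0) (cd Phi) k s = S (b2n (nth k l false)))).
  { apply eventually_forall_lt. intros k Hk. rewrite <- (Hl k Hk).
    rewrite <- is_cantor_b2n by assumption. apply run_complete, (Phi_r k). }
  apply (run_complete (orc X 1)) in Hy.
  refine (eventually_impl _ _ _ (eventually_and _ _ HPhi
            (eventually_and _ _ Hy (eventually_gt (code l))))).
  intros s (H1 & H2 & H3). unfold uncovered.
  enough (s - search (covers (cd ew) X (cd Phi) i s) s <> 0) by now destruct (s - _).
  intros H. apply search_full with (k := code l) in H; [|exact H3].
  unfold covers in H. rewrite H2 in H.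
  replace (S (code l) - _) with 0 in H; [discriminate|].
  symmetry. apply search_full. intros k _. unfold mismatch.
  destruct (Nat.lt_ge_cases k (length l)) as [Hk|Hk].
  - destruct (tail_code_lt l k Hk) as (u & -> & ->). rewrite H1 by assumption. lia.
  - now rewrite tail_code, skipn_all2.
Qed.

(** The finitely many components below [i] are eventually covered, and [i] itself never is. *)
Lemma layer_limit i e :
  ~ U i (to_cantor r) -> (forall j, j < i -> U j (to_cantor r)) ->
  pi1 e = cd Phi -> eventually (fun s => index X s = e) ->
  eventually (fun s => layer (cd ew) X s = i).
Proof.
  intros Hi Hj He Hidx.
  assert (H : eventually (fun s => forall j, j < i -> uncovered (cd ew) X (cd Phi) s j = 0)).
  { apply eventually_forall_lt. intros j Hlt. now apply uncovered_inside, Hj. }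
  refine (eventually_impl _ _ _ (eventually_and _ _ Hidx
            (eventually_and _ _ H (eventually_gt i)))).
  intros s (H1 & H2 & H3). unfold layer. rewrite H1, He.
  apply search_eq; [exact H3|exact H2|]. now rewrite uncovered_outside.
Qed.
End Layer.

(** * The realizer returning least layers *)

Definition least_outside (U : nat -> cantor -> Prop) (X : cantor) (i : nat) : Prop :=
  ~ U i X /\ forall j, j < i -> U j X.

Lemma least_outside_exists U X :
  ~ (forall i, U i X) -> exists i, least_outside U X i.
Proof.
  intros H. apply not_all_ex_not in H as [i Hi]. revert Hi.
  induction i as [i IH] using lt_wf_ind. intros Hi.
  destruct (classic (exists j, j < i /\ ~ U j X)) as [(j & Hj & Hn)|Hn]; [eauto|].
  exists i. split; [exact Hi|]. intros j Hj.
  destruct (classic (U j X)); [assumption|]. exfalso; eauto.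
Qed.

Lemma least_outside_unique U X i j :
  least_outside U X i -> least_outside U X j -> i = j.
Proof.
  intros [Hi Hi'] [Hj Hj'].
  destruct (Nat.lt_trichotomy i j) as [H|[H|H]]; [|exact H|]; exfalso; auto.
Qed.

(** Realizers may be noncomputable, so least layers are allowed. Restricting the domain to
    [MLR_name] makes any query it answers a binary sequence. *)
Definition least_layer (U : nat -> cantor -> Prop) (p q : baire) : Prop :=
  MLR_name p /\ exists i, least_outside U (to_cantor p) i /\ q = nat_name i.

Lemma least_layer_realizes U : ML_test U -> realizes_LAY U (least_layer U).
Proof.
  intros HU. split.
  - intros p q q' (_ & i & Hi & ->) (_ & j & Hj & ->) n.
    now rewrite (least_outside_unique U _ i j Hi Hj).
  - intros p Hp. destruct (least_outside_exists U (to_cantor p)) as [i Hi].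
    { now apply (proj2 Hp). }
    exists (nat_name i). split; [now split; [|exists i]|].
    intros q (_ & j & Hj & ->). exists j. split; [reflexivity|apply Hj].
Qed.

(** By universality, a sequence outside some [U i] is random. Without randoms the cylinder would lie
    in [U (S (length l))], whose measure is at most half that of the cylinder. *)
Lemma random_above_cylinder U l :
  universal_ML_test U -> exists X, MLR X /\ cyl l X.
Proof.
  intros [(_ & _ & Hm) Huniv]. apply NNPP. intros Hn.
  specialize (Hm (S (length l)) [l]). cbn [fold_right] in Hm.
  assert (H : ((/ 2) ^ length l + 0 <= (/ 2) ^ S (length l))%R).
  { apply Hm.
    - constructor; [easy|constructor].
    - intros s t [<-|[]] [<-|[]] Hne. now destruct Hne.
    - intros s [<-|[]] X HX. apply NNPP. intros HU. apply Hn. exists X.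
      split; [|exact HX]. intros V HV HVX. apply HU. now apply (Huniv V). }
  assert (0 < (/ 2) ^ length l)%R by (apply pow_lt; lra).
  cbn [pow] in H. lra.
Qed.

Lemma index_cylinder X e s :
  cyl (repeat false e ++ [true]) X -> s > e -> index (to_baire X) s = e.
Proof.
  intros HX Hs. unfold cyl in HX. rewrite length_app, repeat_length in HX. cbn in HX.
  unfold index, to_baire. apply search_eq; [exact Hs| |].
  - intros j Hj. rewrite HX by lia. rewrite app_nth1 by (rewrite repeat_length; lia).
    now rewrite nth_repeat.
  - rewrite HX by lia. rewrite app_nth2, repeat_length, Nat.sub_diag by (rewrite repeat_length; lia).
    easy.
Qed.

(** * The diagonal argument *)

Theorem theorem5p16 :
  forall U : nat -> cantor -> Prop,
    universal_ML_test U ->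
    exists A : cantor -> Prop, Sigma02 A /\ ~ chiMLR_leW_LAY A U.
Proof.
  intros U HU. destruct (proj1 HU) as (U_open & [ew U_enum] & _).
  exists (fun X => eventually (fun s => diag (cd ew) (to_baire X) s = 0)).
  destruct (computable_diag (cd ew)) as [d Hd]. split.
  - exists d. split; [eauto|]. intros X.
    split; apply eventually_impl; intros s H.
    + rewrite <- H. apply Hd.
    + exact (eval_det _ _ _ _ _ (Hd _ _) H).
  - intros (Phi & Psi & Hred).
    set (e := pair (cd Phi) (cd Psi)).
    destruct (random_above_cylinder U (repeat false e ++ [true]) HU) as (X & HX & Hcyl).
    (* With this realizer the reduction receives exactly the limit [i] of the layer approximation
       for [r], the output of [Phi]. *)
    destruct (Hred _ (least_layer_realizes U (proj1 HU)) (to_baire X))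
      as (r & q & n & HPhi & ((Hr & _) & i & [Hi Hj] & ->) & HPsi & Hchi).
    { split; [intros k; unfold to_baire; destruct (X k); auto|].
      now rewrite to_cantor_to_baire. }
    rewrite to_cantor_to_baire in Hchi.
    assert (Hidx : eventually (fun s => index (to_baire X) s = e)).
    { exists e. intros s Hs. now apply index_cylinder. }
    assert (Hlay : eventually (fun s => layer (cd ew) (to_baire X) s = i)).
    { apply layer_limit with U Phi r e; auto. apply pi1_pair. }
    (* Oracle [i + 2] is convertible with [join (to_baire X) (nat_name i)]. *)
    pose proof (run_complete (orc (to_baire X) (S (S i))) Psi 1 _ (HPsi 1)) as Hrun.
    assert (Hdiag : eventually (fun s => diag (cd ew) (to_baire X) s = nat_name n 1)).
    { refine (eventually_impl _ _ _ (eventually_and _ _ Hidx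
                (eventually_and _ _ Hlay Hrun))).
      intros s (H1 & H2 & H3). unfold diag. rewrite H1, H2. unfold e.
      now rewrite pi2_pair, H3. }
    (* If [n = 1], [diag] is eventually both [0] and [1]; if [n = 0], it is eventually [0], which
       puts [X] in the set. *)
    destruct Hchi as [[HA ->]|[HA ->]].
    + destruct (eventually_and _ _ HA Hdiag) as [s0 Hs].
      destruct (Hs (S s0) (le_n _)) as [E1 E2]. now rewrite E1 in E2.
    + exact (HA Hdiag).
Qed.
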